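(* Flutter (as defined in the context) satisfies Agreement and Total Order: in every execution, all correct servers eventually deliver the same messages in the same order, i.e. all correct servers trigger the same (finite or infinite) sequence of $\langle tob.\mathrm{Deliver}\mid\cdot,\cdot\rangle$ events over the whole execution.
   Context: **Model.** $f\ge 0$ is an integer; $\Pi$ is a fixed, commonly known set of $n=5f+1$ servers, of which at most $f$ are faulty (Byzantine: may behave arbitrarily and collude); $\Theta$ is a set of clients (possibly overlapping with $\Pi$), any number of which may be faulty; $\mathcal M$ is the set of messages; $\mathbb T$ denotes times (real numbers). Correct processes follow the algorithm. Any two processes (including a process and itself) communicate via reliable, authenticated, FIFO links. Partial synchrony: message delays are bounded by an unknown constant $\Delta$, and the difference between real time and the local time of any process is bounded by an unknown constant $\Psi$. Local clocks are non-decreasing; $local\_time()$ reads the local clock. Event handlers execute atomically, and a process delivers only finitely many messages in finite time. Correct clients never broadcast the same message twice. **Representative Binary Consensus** (instance $con$): every correct server proposes one value of $\mathbb B=\{\mathtt{True},\mathtt{False}\}$ via $\langle con.\mathrm{Propose}\mid p\rangle$, and may trigger $\langle con.\mathrm{Decide}\mid d\rangle$. Integrity: no correct server decides more than once. Agreement: no two correct servers decide different values. Termination: if every correct server proposes, every correct server eventually decides. Representative Validity: a decided value was proposed by at least $f+1$ correct servers. **Order.** Fix total orders on $\Theta$ and $\mathcal M$; $\Theta\times\mathcal M\times\mathbb T$ is totally ordered by comparing first the time component, then the client, then the message. The initial value $(\bot,\bot,-\infty)$ is below every element. **Flutter, server algorithm.** There is one independent Representative Binary Consensus instance $con[(\theta,m,b)]$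 for every $(\theta,m,b)\in\Theta\times\mathcal M\times\mathbb T$. Each server keeps sets $observed,proposed,candidates\subseteq\Theta\times\mathcal M\times\mathbb T$ and $delivered\subseteq\Theta\times\mathcal M$ (all initially empty), a map $remote\_times:\Pi\to\mathbb T\cup\{-\infty\}$ (initially constantly $-\infty$), a map $decisions$ from $\Theta\times\mathcal M\times\mathbb T$ to $\mathbb B$ (initially empty), and $last\_processed$ (initially $(\bot,\bot,-\infty)$). - $beat()$: send $[\mathtt{Time},local\_time()]$ to every server. - Upon delivering $[\mathtt{Time},t]$ from $\pi$: $remote\_times[\pi]=\max(remote\_times[\pi],t)$. - $lock\_time()$: return the maximum $t$ such that $|\{\pi: remote\_times[\pi]\ge t\}|\ge 4f+1$. - $spot(\theta,m,b)$: if $b>lock\_time()$, add $(\theta,m,b)$ to $candidates$. Then, if $(\theta,m,b)\notin observed$: send $[\mathtt{Observe},\theta,m,b]$ to every server, schedule $beat()$ for execution at local time $b$ (immediately if $b$ has already passed), and add $(\theta,m,b)$ to $observed$. - Upon delivering $[\mathtt{Observe},\theta,m,b]$ from a server: $spot(\theta,m,b)$. - Upon delivering $[\mathtt{Message},m,b]$ from a client $\theta$: $spot(\theta,m,b)$; then, if $(\theta,m,b)\notin proposed$: trigger $\langle con[(\theta,m,b)].\mathrm{Propose}\mid (b>local\_time())\rangle$ (the truth value of the inequality) and add $(\theta,m,b)$ to $proposed$. - Upon existence of $(\theta,m,b)\in observed\setminus proposed$ with $b\le local\_time()$: trigger $\langle con[(\theta,m,b)].\mathrm{Propose}\mid\mathtt{False}\rangle$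 and add $(\theta,m,b)$ to $proposed$. - Upon $\langle con[(\theta,m,b)].\mathrm{Decide}\mid v\rangle$: send $[\mathtt{Decision},m,b,v]$ to $\theta$ and set $decisions[(\theta,m,b)]=v$. - Whenever the minimum $(\theta,m,b)$ among the elements of $candidates$ that are $>last\_processed$ exists, is a key of $decisions$, and satisfies $b\le lock\_time()$: if $decisions[(\theta,m,b)]=\mathtt{True}$, call $order(\theta,m,b)$; then set $last\_processed=(\theta,m,b)$. - $order(\theta,m,b)$: if $(\theta,m)\notin delivered$, trigger $\langle tob.\mathrm{Deliver}\mid\theta,m\rangle$ and add $(\theta,m)$ to $delivered$. **Flutter, client algorithm.** Parameters: message-delay estimate $\tilde\Delta>0$ (otherwise arbitrary) and a constant margin $\epsilon>0$. Each client keeps maps $submissions$ from $\mathcal M$ to $\mathbb N\times\mathbb T$ and $decisions$ from $\mathcal M\times\mathbb T\times\Pi$ to $\mathbb B$ (initially empty). - $submit(m,r)$: let $b=local\_time()+2^r\tilde\Delta+\epsilon$; send $[\mathtt{Message},m,b]$ to every server; set $submissions[m]=(r,b)$. - Upon $\langle tob.\mathrm{Broadcast}\mid m\rangle$: $submit(m,0)$. - Upon delivering $[\mathtt{Decision},m,b,v]$ from server $\pi$: $decisions[(m,b,\pi)]=v$. - Upon existence of $m$ with $submissions[m]=(r,b)$ and $|\{\pi: decisions[(m,b,\pi)]=\mathtt{False}\}|\ge f+1$: $submit(m,r+1)$. *)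

(* Defs.v *)
From mathcomp Require Import all_boot all_order all_algebra.
From mathcomp Require Import finmap.
From mathcomp Require Import all_classical all_reals ereal.

Set Implicit Arguments.
Unset Strict Implicit.
Unset Printing Implicit Defensive.

Import Order.TTheory GRing.Theory Num.Theory.

Local Open Scope fset_scope.
Local Open Scope fmap_scope.
Local Open Scope ring_scope.

Section Flutter.

(* [Server] is Pi and [Client] is Theta.  Both are embedded by [srv] and [cli]
   into the type [Proc] of processes; the images may overlap, in which case one
   process (one clock, one link to each peer) runs both algorithms. *)
Context {R : realType} {dC dM : Order.disp_t}.
Context {Client : orderType dC} {Msg : orderType dM}.
Context {Server : finType} {Proc : eqType}.
Context (f : nat) (srv : Server -> Proc) (cli : Client -> Proc).
Context (delay_estimate margin : R).

Definition triple : Type := (Client * Msg * R)%type.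

Definition key (x : triple) : R *l (Client *l Msg) := (x.2, (x.1.1, x.1.2)).

Inductive wire :=
| TimeMsg of R
| ObserveMsg of triple
| MessageMsg of Msg & R
| DecisionMsg of Msg & R & bool.

Inductive output :=
| Send of Proc & wire
| Propose of triple & bool
| TobDeliver of Client & Msg.

Definition to_servers (w : wire) : seq output :=
  [seq Send (srv pi) w | pi <- enum Server].

(* [scheduled] holds the pending executions of beat().  Each is identified by
   the triple whose spot requested it, since a triple enters [observed] only
   once.  The value [None] of [last_processed] is (bot, bot, -oo). *)
Record server_state := ServerState {
  observed : {fset triple};
  proposed : {fset triple};
  candidates : {fset triple};
  delivered : {fset Client * Msg};
  remote_times : Server -> \bar R;
  decisions : {fmap triple -> bool};
  last_processed : option triple;
  scheduled : {fset triple} }.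

Definition server_init : server_state :=
  ServerState fset0 fset0 fset0 fset0 (fun=> -oo%E) fmap0 None fset0.

Definition add_observed x s :=
  let: ServerState ob pr ca de rt dc lp sc := s in
  ServerState (x |` ob) pr ca de rt dc lp sc.
Definition add_proposed x s :=
  let: ServerState ob pr ca de rt dc lp sc := s in
  ServerState ob (x |` pr) ca de rt dc lp sc.
Definition add_candidate x s :=
  let: ServerState ob pr ca de rt dc lp sc := s in
  ServerState ob pr (x |` ca) de rt dc lp sc.
Definition add_delivered d s :=
  let: ServerState ob pr ca de rt dc lp sc := s in
  ServerState ob pr ca (d |` de) rt dc lp sc.
Definition raise_remote_time (pi : Server) (t : R) s :=
  let: ServerState ob pr ca de rt dc lp sc := s in
  ServerState ob pr ca de
    (fun pi' => if pi' == pi then Order.max (rt pi') t%:E else rt pi') dc lp sc.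
Definition set_decision x v s :=
  let: ServerState ob pr ca de rt dc lp sc := s in
  ServerState ob pr ca de rt dc.[x <- v] lp sc.
Definition set_last_processed x s :=
  let: ServerState ob pr ca de rt dc lp sc := s in
  ServerState ob pr ca de rt dc (Some x) sc.
Definition add_scheduled x s :=
  let: ServerState ob pr ca de rt dc lp sc := s in
  ServerState ob pr ca de rt dc lp (x |` sc).
Definition remove_scheduled x s :=
  let: ServerState ob pr ca de rt dc lp sc := s in
  ServerState ob pr ca de rt dc lp (sc `\ x).

(* The supremum is a maximum when there are at least 4f+1 servers: see
   [lock_time_max] below. *)
Definition lock_time (s : server_state) : \bar R :=
  ereal_sup
    [set t | (4 * f + 1 <= #|[pred pi | (t <= remote_times s pi)%E]|)%N]%classic.

(* Here and below, [now] is the value of local_time() during the handler, and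
   a handler returns the new state with its outputs in program order. *)
Definition beat (now : R) : seq output := to_servers (TimeMsg now).

Definition spot (now : R) (x : triple) (s : server_state) :
    server_state * seq output :=
  let s1 := if (lock_time s < x.2%:E)%E then add_candidate x s else s in
  if x \in observed s1 then (s1, [::])
  else if x.2 <= now then
    (add_observed x s1, to_servers (ObserveMsg x) ++ beat now)
  else
    (add_observed x (add_scheduled x s1), to_servers (ObserveMsg x)).

Definition propose (x : triple) (v : bool) (s : server_state) :
    server_state * seq output :=
  (add_proposed x s, [:: Propose x v]).

Definition order (x : triple) (s : server_state) :
    server_state * seq output :=
  if x.1 \in delivered s then (s, [::])
  else (add_delivered x.1 s, [:: TobDeliver x.1.1 x.1.2]).

Inductive server_event :=
| RecvTime of Server & R
| RecvObserve of Server & triple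
| RecvMessage of Client & Msg & R
| Decide of triple & bool
| Beat of triple
| Expire of triple
| Process of triple.

Definition unprocessed (s : server_state) (x : triple) : bool :=
  (x \in candidates s) &&
  (if last_processed s is Some y then (key y < key x)%O else true).

Definition server_guard (now : R) (s : server_state) (e : server_event) : Prop :=
  match e with
  | Beat x => x \in scheduled s /\ x.2 <= now
  | Expire x => [/\ x \in observed s, x \notin proposed s & x.2 <= now]
  | Process x =>
      [/\ unprocessed s x,
          (forall y, unprocessed s y -> (key x <= key y)%O),
          x \in decisions s
        & (x.2%:E <= lock_time s)%E]
  | _ => True
  end.

Definition server_step (now : R) (s : server_state) (e : server_event) :
    server_state * seq output :=
  match e with
  | RecvTime pi t => (raise_remote_time pi t s, [::])
  | RecvObserve _ x => spot now x s
  | RecvMessage theta m b =>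
      let x := (theta, m, b) in
      let: (s1, o1) := spot now x s in
      if x \in proposed s1 then (s1, o1) else
      let: (s2, o2) := propose x (now < b) s1 in (s2, o1 ++ o2)
  | Decide x v =>
      (set_decision x v s, [:: Send (cli x.1.1) (DecisionMsg x.1.2 x.2 v)])
  | Beat x => (remove_scheduled x s, beat now)
  | Expire x => propose x false s
  | Process x =>
      let: (s1, o1) :=
        if (decisions s).[? x] == Some true then order x s else (s, [::]) in
      (set_last_processed x s1, o1)
  end.

Record client_state := ClientState {
  submissions : {fmap Msg -> nat * R};
  client_decisions : {fmap Msg * R * Server -> bool} }.

Definition client_init : client_state := ClientState fmap0 fmap0.

Definition submit (now : R) (m : Msg) (r : nat) (s : client_state) :
    client_state * seq output :=
  let b := now + 2 ^+ r * delay_estimate + margin in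
  (ClientState (submissions s).[m <- (r, b)] (client_decisions s),
   to_servers (MessageMsg m b)).

Inductive client_event :=
| TobBroadcast of Msg
| RecvDecision of Server & Msg & R & bool
| Resubmit of Msg.

Definition client_guard (s : client_state) (e : client_event) : Prop :=
  match e with
  | Resubmit m => exists r b,
      (submissions s).[? m] = Some (r, b) /\
      (f + 1 <=
        #|[pred pi | (client_decisions s).[? (m, b, pi)] == Some false]|)%N
  | _ => True
  end.

Definition client_step (now : R) (s : client_state) (e : client_event) :
    client_state * seq output :=
  match e with
  | TobBroadcast m => submit now m 0 s
  | RecvDecision pi m b v =>
      (ClientState (submissions s) (client_decisions s).[(m, b, pi) <- v], [::])
  | Resubmit m =>
      if (submissions s).[? m] is Some (r, _) then submit now m r.+1 s
      else (s, [::])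
  end.

Inductive event :=
| ServerEv of server_event
| ClientEv of client_event
| Idle.

(* Every process has its own infinite sequence of atomic steps (padded with
   [Idle]), stamped with real times; there is no global interleaving, as the
   set of clients may be infinite.  Only the steps and clocks of correct
   processes are meaningful. *)
Record execution := Execution {
  correct : {pred Proc};
  clock : Proc -> R -> R;
  event_at : Proc -> nat -> event;
  time_at : Proc -> nat -> R }.

Definition guard (now : R) (s : server_state * client_state) (e : event) : Prop :=
  match e with
  | ServerEv e => server_guard now s.1 e
  | ClientEv e => client_guard s.2 e
  | Idle => True
  end.

Definition step (now : R) (s : server_state * client_state) (e : event) :
    (server_state * client_state) * seq output :=
  match e with
  | ServerEv e => let: (s1, o) := server_step now s.1 e in ((s1, s.2), o)
  | ClientEv e => let: (s2, o) := client_step now s.2 e in ((s.1, s2), o)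
  | Idle => (s, [::])
  end.

Definition internal (e : event) : bool :=
  match e with
  | ServerEv (Beat _) | ServerEv (Expire _) | ServerEv (Process _)
  | ClientEv (Resubmit _) => true
  | _ => false
  end.

Section Execution.
Variable ex : execution.

Definition local_time (p : Proc) (k : nat) : R := clock ex p (time_at ex p k).

(* The state of [p] before its step [k]. *)
Fixpoint state_at (p : Proc) (k : nat) : server_state * client_state :=
  if k is k'.+1 then (step (local_time p k') (state_at p k') (event_at ex p k')).1
  else (server_init, client_init).

Definition outputs_at (p : Proc) (k : nat) : seq output :=
  (step (local_time p k) (state_at p k) (event_at ex p k)).2.

(* [x] is the element of index [i] of the (finite or infinite) concatenation
   h 0 ++ h 1 ++ h 2 ++ ... *)
Definition nth_in {T : Type} (h : nat -> seq T) (i : nat) (x : T) : Prop :=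
  exists k, onth (flatten [seq h j | j <- iota 0 k]) i = Some x.

(* The messages, stamped with the current time, that [p] sends to [q],
   resp. that [q] delivers from [p], in its step [k]. *)
Definition sent (p q : Proc) (k : nat) : seq (wire * R) :=
  pmap (fun o => if o is Send q' w then
                   if q' == q then Some (w, time_at ex p k) else None
                 else None)
       (outputs_at p k).

Definition delivery (e : event) : option (Proc * wire) :=
  match e with
  | ServerEv (RecvTime pi t) => Some (srv pi, TimeMsg t)
  | ServerEv (RecvObserve pi x) => Some (srv pi, ObserveMsg x)
  | ServerEv (RecvMessage theta m b) => Some (cli theta, MessageMsg m b)
  | ClientEv (RecvDecision pi m b v) => Some (srv pi, DecisionMsg m b v)
  | _ => None
  end.

Definition received (q p : Proc) (k : nat) : seq (wire * R) :=
  if delivery (event_at ex q k) is Some (p', w) then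
    if p' == p then [:: (w, time_at ex q k)] else [::]
  else [::].

(* The link from [p] to [q] neither loses, duplicates, reorders nor invents
   messages, and delays them by at most [Delta].  It is only required between
   correct processes: a faulty sender may have anything delivered in its own
   name. *)
Definition link (Delta : R) (p q : Proc) : Prop :=
  (forall i w t', nth_in (received q p) i (w, t') ->
     exists2 t, nth_in (sent p q) i (w, t) & t <= t') /\
  (forall i w t, nth_in (sent p q) i (w, t) ->
     exists2 t', nth_in (received q p) i (w, t') & t' <= t + Delta).

Definition correct_server (pi : Server) : bool := srv pi \in correct ex.

Definition proposes (pi : Server) (x : triple) (v : bool) (k : nat) : Prop :=
  (x, v) \in pmap (fun o => if o is Propose y w then Some (y, w) else None)
                  (outputs_at (srv pi) k).

Definition decides (pi : Server) (x : triple) (v : bool) (k : nat) : Prop :=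
  event_at ex (srv pi) k = ServerEv (Decide x v).

(* Representative Binary Consensus, instance con[x], as a black box: its own
   messages are not modelled and [Decide] events are constrained only by these
   properties. *)
Record consensus (x : triple) : Prop := {
  con_integrity : forall pi v v' k k', correct_server pi ->
    decides pi x v k -> decides pi x v' k' -> k = k';
  con_agreement : forall pi pi' v v' k k',
    correct_server pi -> correct_server pi' ->
    decides pi x v k -> decides pi' x v' k' -> v = v';
  con_termination :
    (forall pi, correct_server pi -> exists v k, proposes pi x v k) ->
    forall pi, correct_server pi -> exists v k, decides pi x v k;
  con_representative_validity : forall pi v k,
    correct_server pi -> decides pi x v k ->
    exists2 A : {set Server}, (f + 1 <= #|A|)%N &
      forall rho, rho \in A -> correct_server rho /\
        exists2 j, proposes rho x v j &
                   time_at ex (srv rho) j <= time_at ex (srv pi) k }.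

(* [ex_progress] is weak fairness of the "upon existence", "whenever" and
   scheduled handlers: a beat scheduled for local time b is executed
   eventually, at a local time at least b. *)
Record flutter_execution (Delta Psi : R) : Prop := {
  ex_faulty : (#|[pred pi | ~~ correct_server pi]| <= f)%N;
  ex_clock_mono : forall p, p \in correct ex ->
    {homo clock ex p : t u / t <= u};
  ex_clock_drift : forall p, p \in correct ex ->
    forall t, `|clock ex p t - t| <= Psi;
  ex_time_mono : forall p, p \in correct ex ->
    {homo time_at ex p : j k / (j <= k)%N >-> j <= k};
  ex_time_diverges : forall p, p \in correct ex ->
    forall t, exists k, t < time_at ex p k;
  ex_server_role : forall p k e, p \in correct ex ->
    event_at ex p k = ServerEv e -> exists pi, p = srv pi;
  ex_client_role : forall p k e, p \in correct ex ->
    event_at ex p k = ClientEv e -> exists theta, p = cli theta;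
  ex_guard : forall p k, p \in correct ex ->
    guard (local_time p k) (state_at p k) (event_at ex p k);
  ex_progress : forall p e k, p \in correct ex -> internal e ->
    (forall j, (k <= j)%N -> guard (local_time p j) (state_at p j) e) ->
    exists2 j, (k <= j)%N & event_at ex p j = e;
  ex_links : forall p q, p \in correct ex -> q \in correct ex ->
    link Delta p q;
  ex_consensus : forall x, consensus x;
  ex_broadcast_once : forall theta m k k', cli theta \in correct ex ->
    event_at ex (cli theta) k = ClientEv (TobBroadcast m) ->
    event_at ex (cli theta) k' = ClientEv (TobBroadcast m) -> k = k' }.

Definition tob_deliveries (pi : Server) (k : nat) : seq (Client * Msg) :=
  pmap (fun o => if o is TobDeliver theta m then Some (theta, m) else None)
       (outputs_at (srv pi) k).

Definition same_deliveries (pi pi' : Server) : Prop :=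
  forall i d,
    nth_in (tob_deliveries pi) i d <-> nth_in (tob_deliveries pi') i d.

End Execution.

Lemma lock_time_max (s : server_state) : (4 * f + 1 <= #|Server|)%N ->
  (4 * f + 1 <= #|[pred pi | (lock_time s <= remote_times s pi)%E]|)%N /\
  (forall t : \bar R,
     (4 * f + 1 <= #|[pred pi | (t <= remote_times s pi)%E]|)%N ->
     (t <= lock_time s)%E).
Proof.
move=> n4; split; last by move=> t ht; exact: ereal_sup_ubound.
pose Q (t : \bar R) :=
  (4 * f + 1 <= #|[pred pi | (t <= remote_times s pi)%E]|)%N.
have [/existsP[p0 Qp0]|/existsPn noQ] := boolP [exists pi, Q (remote_times s pi)].
  case: (@arg_maxP _ _ _ p0 (fun pi => Q (remote_times s pi)) (remote_times s) Qp0).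
  move=> p Qp pmax; suff -> : lock_time s = remote_times s p by [].
  apply/eqP; rewrite eq_le; apply/andP; split; last exact: ereal_sup_ubound.
  apply: ge_ereal_sup => t Qt.
  have /card_gt0P[q0 tq0] : (0 < #|[pred pi | (t <= remote_times s pi)%E]|)%N.
    by apply: leq_trans Qt; rewrite addn1.
  case: (@arg_minP _ _ _ q0 (fun pi => (t <= remote_times s pi)%E)
           (remote_times s) tq0) => q tq qmin.
  apply: le_trans tq (pmax q _); apply: leq_trans Qt _.
  by apply/subset_leq_card/fintype.subsetP => r; rewrite !inE; apply: qmin.
have [q0 _] : exists q0 : Server, true.
  have /card_gt0P[q0 _] : (0 < #|Server|)%N by apply: leq_trans n4; rewrite addn1.
  by exists q0.
case: (@arg_minP _ _ _ q0 xpredT (remote_times s) isT) => q _ qmin.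
case/negP: (noQ q); apply: leq_trans n4 _.
by apply/subset_leq_card/fintype.subsetP => r _; rewrite inE; apply: qmin.
Qed.

End Flutter.

(* Main.v *)
(* A server stops accepting candidates stamped at most b once its lock time
   reaches b, and it processes candidates in increasing order, so the processed
   sequence only ever grows at its end.  Every observed triple is relayed, hence
   observed, proposed and decided at every correct server, and the beats it
   triggers push every correct lock time past its stamp: every candidate is
   eventually processed.  A triple decided True becomes a candidate at every
   correct server, by quorum intersection and FIFO links.  Hence the triples
   decided True that two correct servers process are initial segments of one and
   the same increasing sequence, and the delivery sequence is obtained by erasing
   repetitions of (client, message) from it. *)

From HB Require Import structures.
Require Import Defs.
From mathcomp Require Import all_boot all_order all_algebra.
From mathcomp Require Import finmap.
From mathcomp Require Import all_classical all_reals ereal.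

Set Implicit Arguments.
Unset Strict Implicit.
Unset Printing Implicit Defensive.

Import Order.TTheory GRing.Theory Num.Theory.

Local Open Scope fset_scope.
Local Open Scope fmap_scope.
Local Open Scope ring_scope.

(** * Finite prefixes of an infinite concatenation *)

Section History.
Context {T : Type} (h : nat -> seq T).

Definition history (k : nat) : seq T := flatten [seq h j | j <- iota 0 k].

Lemma historyS k : history k.+1 = history k ++ h k.
Proof.
by rewrite /history -addn1 iotaD map_cat flatten_cat /= cats0 add0n.
Qed.

Lemma onth_prefix (s t : seq T) i x : onth s i = Some x -> onth (s ++ t) i = Some x.
Proof.
move=> e; rewrite onth_cat; case: ifP => // /negP[].
by rewrite -onthTE e.
Qed.

Lemma history_le j k : (j <= k)%N -> exists s, history k = history j ++ s.
Proof.
move=> /subnKC <-; elim: (k - j)%N => [|d [s IH]].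
  by exists [::]; rewrite addn0 cats0.
by exists (s ++ h (j + d)); rewrite addnS historyS IH catA.
Qed.

Lemma size_history_le j k : (j <= k)%N -> (size (history j) <= size (history k))%N.
Proof. by move=> /history_le[s ->]; rewrite size_cat leq_addr. Qed.

(** This translates the positions used by the link properties into steps and offsets, where FIFO
    order becomes a comparison of history sizes. *)
Lemma nth_inP i x : nth_in h i x <->
  exists k j, onth (h k) j = Some x /\ i = (size (history k) + j)%N.
Proof.
split=> [[k]|[k [j [e ->]]]]; last first.
  exists k.+1; rewrite -/(history k.+1) historyS onth_cat.
  by rewrite ltnNge leq_addr /= addKn.
rewrite -/(history k); elim: k => [|k IH]; first by rewrite onth0n.
rewrite historyS onth_cat; case: ltnP => [_ /IH //|le e].
by exists k, (i - size (history k))%N; rewrite e subnKC.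
Qed.

End History.

(** * Auxiliary facts on sequences and on the order of triples *)

Lemma sorted_prefix (T : eqType) (r : rel T) (s t : seq T) :
  irreflexive r -> transitive r -> sorted r s -> sorted r t -> {subset s <= t} ->
  (forall x y, x \in t -> y \in s -> r x y -> x \in s) -> prefix s t.
Proof.
move=> irr tr; elim: s t => [|a s IH] [|b t] //= rs rt st low.
  by have := st a (mem_head _ _).
have ra := allP (order_path_min tr rs); have rb := allP (order_path_min tr rt).
have nlt x y : r x y -> ~ r y x.
  by move=> /tr h /h; rewrite irr.
(* The heads agree: otherwise [a] occurs later in [t], hence above [b], and downward closure puts
   [b] in [s], below the first element of [s]. *)
have ab : a = b.
  have := st a (mem_head _ _); rewrite in_cons => /orP[/eqP //|/rb ba].
  have := low b a (mem_head _ _) (mem_head _ _) ba.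
  by rewrite in_cons => /orP[/eqP //|/ra /nlt].
subst b; rewrite eqxx /=; apply: IH (path_sorted rs) (path_sorted rt) _ _.
  move=> x xs; have := st x; rewrite !in_cons xs orbT => /(_ isT) /orP[/eqP xa|//].
  by have := ra x xs; rewrite xa irr.
move=> x y xt ys xy; have := low x y; rewrite !in_cons xt ys !orbT.
move=> /(_ isT isT xy) /orP[/eqP xa|//].
by have := rb x xt; rewrite xa irr.
Qed.

Lemma seq_key_min (T : eqType) (d : Order.disp_t) (K : orderType d) (h : T -> K)
    (s : seq T) x : x \in s ->
  exists2 z, z \in s & forall y, y \in s -> (h z <= h y)%O.
Proof.
elim: s x => // a [|b s] IH x _.
  by exists a; rewrite ?mem_head // => y; rewrite mem_seq1 => /eqP ->.
have [z zs zmin] := IH b (mem_head _ _).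
have [az|za] := leP (h a) (h z).
  exists a; first exact: mem_head.
  by move=> y; rewrite in_cons => /orP[/eqP -> //|/zmin]; exact: le_trans.
exists z; first by rewrite in_cons zs orbT.
by move=> y; rewrite in_cons => /orP[/eqP -> |/zmin //]; exact: ltW.
Qed.

Lemma eventually_all (T : eqType) (P : nat -> T -> Prop) (s : seq T) :
  (forall j k x, (j <= k)%N -> P j x -> P k x) ->
  (forall x, x \in s -> exists k, P k x) ->
  exists K, forall x, x \in s -> P K x.
Proof.
move=> mono; elim: s => [|a s IH] ev; first by exists 0%N.
have [|K PK] := IH; first by move=> x xs; apply: ev; rewrite in_cons xs orbT.
have [k Pk] := ev a (mem_head _ _); exists (maxn K k) => x.
rewrite in_cons => /orP[/eqP ->|/PK].
  exact: mono (leq_maxr _ _) Pk.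
exact: mono (leq_maxl _ _).
Qed.

Lemma key_lt (R : realType) (dC dM : Order.disp_t) (Client : orderType dC)
    (Msg : orderType dM) (x y : @triple R dC dM Client Msg) :
  x.2 < y.2 -> (key x < key y)%O.
Proof. by move=> xy; rewrite /key ltxi_pair /= (ltW xy) leNgt xy. Qed.

Lemma key_le (R : realType) (dC dM : Order.disp_t) (Client : orderType dC)
    (Msg : orderType dM) (x y : @triple R dC dM Client Msg) :
  (key x <= key y)%O -> x.2 <= y.2.
Proof. by rewrite /key lexi_pair => /andP[]. Qed.

(* [undup] keeps last occurrences, so [rev (undup (rev s))] keeps the first ones. *)
Lemma prefix_rev_undup_rev (T : eqType) (s t : seq T) :
  prefix (rev (undup (rev s))) (rev (undup (rev (s ++ t)))).
Proof. by rewrite rev_cat undup_cat rev_cat prefix_prefix. Qed.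

(** Equality of messages is decided classically, so that membership in lists of outputs makes
    sense. *)
HB.instance Definition _ (R : realType) (dC dM : Order.disp_t)
  (Client : orderType dC) (Msg : orderType dM) :=
  gen_eqMixin (@wire R dC dM Client Msg).

HB.instance Definition _ (R : realType) (dC dM : Order.disp_t)
  (Client : orderType dC) (Msg : orderType dM) (Proc : eqType) :=
  gen_eqMixin (@output R dC dM Client Msg Proc).

(** * Effect of one step on the state and the outputs *)

Section Steps.
Context {R : realType} {dC dM : Order.disp_t}.
Context {Client : orderType dC} {Msg : orderType dM}.
Context {Server : finType} {Proc : eqType}.
Context (f : nat) (srv : Server -> Proc) (cli : Client -> Proc).
Context (delay_estimate margin : R).

Local Notation triple := (@triple R dC dM Client Msg).
Local Notation server_state := (@server_state R dC dM Client Msg Server).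
Local Notation client_state := (@client_state R dM Msg Server).
Local Notation event := (@event R dC dM Client Msg Server).
Local Notation step := (step f srv cli delay_estimate margin).

Implicit Types (now : R) (s : server_state * client_state) (e : event).
Implicit Types (x : triple) (w : @wire R dC dM Client Msg).

HB.instance Definition _ := gen_eqMixin event.

Lemma key_inj : injective (@key R dC dM Client Msg).
Proof. by case=> [[a b] c] [[a' b'] c'] [-> -> ->]. Qed.

Definition spotted e : option triple :=
  match e with
  | ServerEv (RecvObserve _ x) => Some x
  | ServerEv (RecvMessage theta m b) => Some (theta, m, b)
  | _ => None
  end.

(** [RecvMessage] counts even when its triple is already proposed: inserting it again leaves
    [proposed] unchanged. *)
Definition newly_proposed e : option triple :=
  match e with
  | ServerEv (Expire x) => Some x
  | ServerEv (RecvMessage theta m b) => Some (theta, m, b)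
  | _ => None
  end.

Ltac step_cases s e :=
  case: s => -[ob pr ca de rt dc lp sc] cs;
  case: e => [[pi t0|pi y|th m b|y w|y|y|y]|[m|pi m b w|m]|] //=;
  rewrite /spot /Defs.order /propose //=;
  try (case: (submissions _).[? _] => [[? ?]|] //=);
  try (case: (lock_time _ _ < _)%E => //=);
  repeat (case: ifP => [?|/negP ?] //=).

Lemma step_observed now s e :
  observed (step now s e).1.1 =
  if spotted e is Some x then x |` observed s.1 else observed s.1.
Proof. by step_cases s e; rewrite mem_fset1U. Qed.

Lemma step_candidates now s e :
  candidates (step now s e).1.1 =
  if spotted e is Some x then
    if (lock_time f s.1 < x.2%:E)%E then x |` candidates s.1 else candidates s.1
  else candidates s.1.
Proof. by step_cases s e. Qed.

Lemma step_proposed now s e :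
  proposed (step now s e).1.1 =
  if newly_proposed e is Some x then x |` proposed s.1 else proposed s.1.
Proof. by step_cases s e; rewrite mem_fset1U. Qed.

Lemma step_remote_times now s e :
  remote_times (step now s e).1.1 =
  if e is ServerEv (RecvTime pi t) then
    fun pi' => if pi' == pi then Order.max (remote_times s.1 pi') t%:E
               else remote_times s.1 pi'
  else remote_times s.1.
Proof. by step_cases s e. Qed.

Lemma step_decisions now s e :
  decisions (step now s e).1.1 =
  if e is ServerEv (Decide x v) then (decisions s.1).[x <- v] else decisions s.1.
Proof. by step_cases s e. Qed.

Lemma step_last_processed now s e :
  last_processed (step now s e).1.1 =
  if e is ServerEv (Process x) then Some x else last_processed s.1.
Proof. by step_cases s e. Qed.

Lemma step_delivered now s e :
  delivered (step now s e).1.1 =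
  if e is ServerEv (Process x) then
    if (decisions s.1).[? x] == Some true then x.1 |` delivered s.1
    else delivered s.1
  else delivered s.1.
Proof. by step_cases s e; rewrite mem_fset1U. Qed.

Lemma step_scheduled now s e x :
  spotted e = Some x -> x \notin observed s.1 -> now < x.2 ->
  x \in scheduled (step now s e).1.1.
Proof.
by step_cases s e => -[<-] /negP // _; rewrite ?fset1U1 // ltNge => /negP.
Qed.

Lemma step_scheduled_keep now s e x :
  e != ServerEv (Beat x) -> x \in scheduled s.1 ->
  x \in scheduled (step now s e).1.1.
Proof.
step_cases s e => ne xsc; rewrite ?in_fset1U ?xsc ?orbT // in_fsetD1 xsc andbT.
by apply: contraNneq ne => ->.
Qed.

Lemma send_to_servers q w : Send (srv q) w \in to_servers srv w.
Proof. by apply: map_f; rewrite mem_enum. Qed.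

Lemma to_serversP o w : o \in to_servers srv w -> exists q, o = Send q w.
Proof. by case/mapP => q _ ->; exists (srv q). Qed.

Definition delivered_by (o : @output R dC dM Client Msg Proc) :=
  if o is TobDeliver theta m then Some (theta, m) else None.

Lemma to_servers_deliver w : pmap delivered_by (to_servers srv w) = [::].
Proof. by rewrite /to_servers; elim: (enum Server). Qed.

Lemma step_deliver now s e :
  pmap delivered_by (step now s e).2 =
  if e is ServerEv (Process x) then
    if ((decisions s.1).[? x] == Some true) && (x.1 \notin delivered s.1)
    then [:: x.1] else [::]
  else [::].
Proof.
step_cases s e; rewrite /beat ?pmap_cat ?to_servers_deliver //.
by case: y.1.
Qed.

Lemma step_send_observe now s e x q :
  spotted e = Some x -> x \notin observed s.1 ->
  Send (srv q) (ObserveMsg x) \in (step now s e).2.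
Proof.
by step_cases s e => -[<-] /negP // _; rewrite ?mem_cat send_to_servers.
Qed.

Lemma step_beat now s e x q :
  spotted e = Some x -> x \notin observed s.1 -> x.2 <= now ->
  Send (srv q) (TimeMsg now) \in (step now s e).2.
Proof.
by step_cases s e => -[<-] /negP // _ //; rewrite ?mem_cat send_to_servers ?orbT.
Qed.

(** Every [TimeMsg] comes from [beat], which stamps the current local time. With monotone clocks,
    the stamp thus dates the sending step. *)
Lemma step_send_time now s e q t :
  Send q (TimeMsg t) \in (step now s e).2 -> t = now.
Proof.
step_cases s e; rewrite /beat ?mem_cat ?mem_seq1;
  by repeat first [by case/to_serversP => ? [] | by move/eqP | case/orP | by []].
Qed.

Lemma step_propose now s e x :
  newly_proposed e = Some x -> x \notin proposed s.1 ->
  exists v, Propose x v \in (step now s e).2.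
Proof.
step_cases s e => -[<-] /negP // _; eexists; rewrite ?mem_cat;
  by first [exact: mem_head | apply/orP; right; exact: mem_head].
Qed.

(** Only [RecvMessage] can propose [true], since [Expire] always proposes [false], and its handler
    spots the triple first. *)
Lemma step_propose_true now s e x :
  Propose x true \in (step now s e).2 -> spotted e = Some x /\ now < x.2.
Proof.
step_cases s e; rewrite /beat ?mem_cat ?mem_seq1;
  by repeat first [by case/to_serversP => ? []
                  | by move/eqP => // -[-> /esym] | case/orP | by []].
Qed.

End Steps.

Section Run.
Context {R : realType} {dC dM : Order.disp_t}.
Context {Client : orderType dC} {Msg : orderType dM}.
Context {Server : finType} {Proc : eqType}.
Context (f : nat) (srv : Server -> Proc) (cli : Client -> Proc).
Context (delay_estimate margin Delta Psi : R).
Context (ex : @execution R dC dM Client Msg Server Proc).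
Context (n_servers : #|Server| = (5 * f + 1)%N) (srv_inj : injective srv).
Context (exP : flutter_execution f srv cli delay_estimate margin ex Delta Psi).

Local Notation triple := (@triple R dC dM Client Msg).
Local Notation st pi k := (state_at f srv cli delay_estimate margin ex (srv pi) k).1.
Local Notation ev pi k := (event_at ex (srv pi) k).
Local Notation now pi k := (local_time ex (srv pi) k).
Local Notation out p k := (outputs_at f srv cli delay_estimate margin ex p k).
Local Notation correct pi := (correct_server srv ex pi).
Local Notation proposes := (proposes f srv cli delay_estimate margin ex).
Local Notation decides := (decides srv ex).
Local Notation sent := (sent f srv cli delay_estimate margin ex).
Local Notation received := (received srv cli ex).
Local Notation delivery := (@delivery R dC dM Client Msg Server Proc srv cli).

Implicit Types (pi rho : Server) (p q : Proc) (x y z : triple).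
Implicit Types (w : @wire R dC dM Client Msg).

(** * Monotonicity of the state along a run *)

Lemma observed_le pi j k x : (j <= k)%N ->
  x \in observed (st pi j) -> x \in observed (st pi k).
Proof.
move=> /subnKC <- xj; elim: (k - j)%N => [|d IH]; first by rewrite addn0.
by rewrite addnS /= step_observed; case: spotted => // y; rewrite in_fset1U IH orbT.
Qed.

Lemma candidates_le pi j k x : (j <= k)%N ->
  x \in candidates (st pi j) -> x \in candidates (st pi k).
Proof.
move=> /subnKC <- xj; elim: (k - j)%N => [|d IH]; first by rewrite addn0.
rewrite addnS /= step_candidates; case: spotted => // y.
by case: ifP => // _; rewrite in_fset1U IH orbT.
Qed.

Lemma decisions_le pi j k x : (j <= k)%N ->
  x \in decisions (st pi j) -> x \in decisions (st pi k).
Proof.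
move=> /subnKC <- xj; elim: (k - j)%N => [|d IH]; first by rewrite addn0.
rewrite addnS /= step_decisions; case: event_at => //-[] // y v.
by rewrite mem_setf; apply/orP; right.
Qed.

Lemma remote_times_le pi rho j k : (j <= k)%N ->
  (remote_times (st pi j) rho <= remote_times (st pi k) rho)%E.
Proof.
move=> /subnKC <-; elim: (k - j)%N => [|d IH]; first by rewrite addn0.
rewrite addnS /= step_remote_times; case: event_at => // -[] // rho' t.
by case: eqP => // _; rewrite le_max IH.
Qed.

Lemma lock_time_le pi j k : (j <= k)%N ->
  (lock_time f (st pi j) <= lock_time f (st pi k))%E.
Proof.
move=> jk; apply: ereal_sup_le => t /= /leq_trans; apply.
apply/subset_leq_card/fintype.subsetP => rho; rewrite !inE => /le_trans; apply.
exact: remote_times_le.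
Qed.

(** * Tracing entries of the state back to events *)

Lemma observed_spotted pi k x : x \in observed (st pi k) ->
  exists2 j, (j < k)%N & spotted (ev pi j) = Some x /\ x \notin observed (st pi j).
Proof.
elim: k => [//|k IH]; have [xk _|xNk] := boolP (x \in observed (st pi k)).
  by have [j jk ?] := IH xk; exists j => //; exact: ltnW.
rewrite /= step_observed; case E: spotted => [y|]; last by rewrite (negPf xNk).
by rewrite in_fset1U (negPf xNk) orbF => /eqP xy; exists k => //; split=> //; rewrite xy.
Qed.

Lemma spotted_observed pi k x : spotted (ev pi k) = Some x ->
  x \in observed (st pi k.+1).
Proof. by move=> e; rewrite /= step_observed e fset1U1. Qed.

Lemma proposed_proposes pi k x : x \in proposed (st pi k) ->
  exists v j, proposes pi x v j.
Proof.
elim: k => [//|k IH]; have [xk _|xNk] := boolP (x \in proposed (st pi k)).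
  exact: IH.
rewrite /= step_proposed; case E: newly_proposed => [y|]; last by rewrite (negPf xNk).
rewrite in_fset1U (negPf xNk) orbF => /eqP xy; rewrite -{y}xy in E.
have [v xv] := step_propose f srv cli delay_estimate margin (now pi k) E xNk.
by exists v, k; rewrite /proposes mem_pmap; apply/mapP; exists (Propose x v).
Qed.

Lemma proposes_true pi k x : proposes pi x true k ->
  spotted (ev pi k) = Some x /\ now pi k < x.2.
Proof.
rewrite /proposes mem_pmap => /mapP[[//|y w|//]] xo [-> wt].
by move: xo; rewrite -wt; exact: step_propose_true.
Qed.

Lemma decisions_decides pi k x v : (decisions (st pi k)).[? x] = Some v ->
  exists2 j, (j < k)%N & decides pi x v j.
Proof.
elim: k => [|k IH]; first by rewrite fnd_fmap0.
rewrite /= step_decisions.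
have old : (decisions (st pi k)).[? x] = Some v ->
    exists2 j, (j < k.+1)%N & decides pi x v j.
  by move=> /IH[j jk ?]; exists j => //; exact: ltnW.
case E: event_at => [[| | |y w| | |]||] //.
rewrite fnd_set; case: eqP => // -> [<-]; by exists k.
Qed.

Lemma decides_decisions pi k x v : decides pi x v k ->
  x \in decisions (st pi k.+1).
Proof. by move=> e; rewrite /= step_decisions e mem_setf; apply/orP; left. Qed.

Lemma candidates_observed pi k x :
  x \in candidates (st pi k) -> x \in observed (st pi k).
Proof.
elim: k => [//|k IH]; rewrite /= step_candidates step_observed.
case: spotted => [y|//].
case: ifP => _; rewrite !in_fset1U; last by move=> /IH ->; rewrite orbT.
by case/orP => [->|/IH ->]; rewrite ?orbT.
Qed.

(** * Reliable FIFO links in terms of steps *)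

Lemma mem_sent p q k w t :
  (w, t) \in sent p q k <-> Send q w \in out p k /\ t = time_at ex p k.
Proof.
rewrite /sent mem_pmap; split=> [/mapP[[q' w'| |]] //|[wo ->]].
  by move=> wo; case: eqP => // qq' -[-> ->]; rewrite -qq'.
by apply/mapP; exists (Send q w) => //; rewrite eqxx.
Qed.

Lemma receivedP q p k w t j : onth (received q p k) j = Some (w, t) <->
  [/\ delivery (event_at ex q k) = Some (p, w), t = time_at ex q k & j = 0%N].
Proof.
rewrite /received; case: delivery => [[p' w']|]; last by rewrite onth0n; split=> // -[].
case: eqP => [->|pp']; last by rewrite onth0n; split=> // -[[]].
rewrite onth1P; split=> [[-> [-> ->]] //|[[->] -> ->] //].
Qed.

Lemma send_delivered p q k w : p \in Defs.correct ex -> q \in Defs.correct ex ->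
  Send q w \in out p k ->
  exists k', delivery (event_at ex q k') = Some (p, w).
Proof.
move=> cp cq wo; have /mem_sent/onthP[j wj] : _ /\ _ := conj wo (erefl (time_at ex p k)).
have [_ /(_ (size (history (sent p q) k) + j)%N w (time_at ex p k))[]] :=
  ex_links exP cp cq.
  by apply/nth_inP; exists k, j.
by move=> t' /nth_inP[k' [j' [/receivedP[] ? _ _ _]]] _; exists k'.
Qed.

(** This is FIFO order: links deliver by position, and [w0] is sent at step [i], before every
    sending of [w]. *)
Lemma delivered_after p q i k w w0 :
  p \in Defs.correct ex -> q \in Defs.correct ex ->
  delivery (event_at ex q k) = Some (p, w) -> Send q w0 \in out p i ->
  (forall j, Send q w \in out p j -> (i < j)%N) ->
  exists2 k0, (k0 < k)%N & delivery (event_at ex q k0) = Some (p, w0).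
Proof.
move=> cp cq wk w0i late; have [rs sr] := ex_links exP cp cq.
have [|t /nth_inP[i' [j [wj e]]] _] := rs (size (history (received q p) k) + 0)%N w
   (time_at ex q k).
  by apply/nth_inP; exists k, 0%N; split=> //; apply/receivedP.
have ii' : (i < i')%N.
  by apply: late; have /mem_sent[] : (w, t) \in sent p q i' by apply/onthP; exists j.
have /mem_sent/onthP[j0 w0j] : _ /\ _ := conj w0i (erefl (time_at ex p i)).
have [|t' /nth_inP[k0 [j1 [/receivedP[wk0 _ ->] e0]]] _] :=
   sr (size (history (sent p q) i) + j0)%N w0 (time_at ex p i).
  by apply/nth_inP; exists i, j0.
(* If [w0] arrived no earlier than [w], the messages sent up to and including step [i] would number
   at most the position of [w0], which is one of them. *)
exists k0 => //; rewrite ltnNge; apply/negP => kk0.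
have := size_history_le (received q p) kk0.
have := size_history_le (sent p q) ii'; rewrite historyS size_cat.
have j0s : (j0 < size (sent p q i))%N by rewrite -onthTE w0j.
move: e e0; rewrite !addn0 => -> <- le1 le2.
have := leq_trans (leq_trans le1 (leq_addr j _)) le2.
by rewrite leq_add2l leqNgt j0s.
Qed.

(** * Unbounded clocks and the number of correct servers *)

Lemma now_le pi j k : correct pi -> (j <= k)%N -> now pi j <= now pi k.
Proof. by move=> cp jk; apply: (ex_clock_mono exP) => //; apply: (ex_time_mono exP). Qed.

Lemma now_unbounded pi b : correct pi -> exists k, b <= now pi k.
Proof.
(* The local clock lags real time by at most [Psi]. *)
move=> cp; have [k tk] := ex_time_diverges exP cp (b + Psi).
exists k; rewrite /local_time; move: tk (ex_clock_drift exP cp (time_at ex (srv pi) k)).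
set t := time_at _ _ _; set c := clock _ _ _ => bt.
rewrite ler_norml lerBrDl => /andP[tc _].
by rewrite -(lerD2r Psi); apply: le_trans (ltW bt) _; rewrite -lerBlDr.
Qed.

Lemma correct_card : (4 * f + 1 <= #|[pred pi | correct pi]|)%N.
Proof.
rewrite -(leq_add2r f) addnAC -mulSnr -n_servers -(cardC [pred pi | correct pi]).
by rewrite leq_add2l; apply: ex_faulty exP.
Qed.

(** * Spread, decision and lock times of observed triples *)

Lemma observed_spotted_everywhere pi rho k x : correct pi -> correct rho ->
  x \in observed (st pi k) -> exists k', spotted (ev rho k') = Some x.
Proof.
move=> cp cr /observed_spotted[j _ [xj xNj]].
have xo : Send (srv rho) (ObserveMsg x) \in out (srv pi) j by exact: step_send_observe.
have [k' e] := send_delivered cp cr xo.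
by exists k'; case: event_at e => [[]|[]|] //= pi' y [_ ->].
Qed.

(** Consensus termination needs a proposal from every correct server. One that spotted [x] but never
    proposed would keep [Expire x] enabled once its clock passes [x.2], and fairness would make it
    propose. *)
Lemma observed_decided pi rho k x : correct pi -> correct rho ->
  x \in observed (st pi k) -> exists k', x \in decisions (st rho k').
Proof.
move=> cp cr xk; have [|v [j xj]] := con_termination (ex_consensus exP x) _ cr.
  move=> {rho cr}rho cr.
  have [k1 /spotted_observed xk1] := observed_spotted_everywhere cp cr xk.
  have [//|noP] := pselect (exists v j, proposes rho x v j).
  have [k2 xk2] := now_unbounded x.2 cr.
  have xN j : x \notin proposed (st rho j).
    by apply/negP => /proposed_proposes.
  have [|j _ ej] := @ex_progress _ _ _ _ _ _ _ _ _ _ _ _ _ _ _ exP (srv rho)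
      (ServerEv (Expire x)) (maxn k1.+1 k2) cr isT.
    move=> j; rewrite geq_max => /andP[k1j k2j]; split=> //.
      exact: observed_le k1j xk1.
    by apply: le_trans xk2 _; exact: now_le.
  case/negP: (xN j.+1); rewrite /= step_proposed ej; exact: fset1U1.
by exists j.+1; exact: decides_decisions xj.
Qed.

(** The beat is immediate if the clock has reached [x.2] when [x] is first spotted; otherwise it is
    scheduled, and the guard of [Beat x] bounds the clock. *)
Lemma observed_beat pi rho k x : correct pi -> x \in observed (st pi k) ->
  exists j, x.2 <= now pi j /\ Send (srv rho) (TimeMsg (now pi j)) \in out (srv pi) j.
Proof.
move=> cp /observed_spotted[j _ [xj xNj]].
have [le|gt] := leP x.2 (now pi j); first by exists j; split=> //; exact: step_beat xj xNj le.
have sj := step_scheduled f srv cli delay_estimate margin xj xNj gt.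
have [[i ei]|noB] := pselect (exists i, ev pi i = ServerEv (Beat x)).
  exists i; have := ex_guard exP i cp; rewrite ei => -[_ le]; split=> //.
  rewrite /outputs_at ei; exact: send_to_servers.
(* As long as [Beat x] does not occur, nothing removes the request, so fairness applies. *)
have sk i : (j < i)%N -> x \in scheduled (st pi i).
  elim: i => // i IH; rewrite ltnS leq_eqVlt => /orP[/eqP <- //|/IH xi].
  apply: step_scheduled_keep xi; apply/eqP => e; apply: noB; by exists i.
have [k2 xk2] := now_unbounded x.2 cp.
have [|i _ ei] := @ex_progress _ _ _ _ _ _ _ _ _ _ _ _ _ _ _ exP (srv pi)
    (ServerEv (Beat x)) (maxn j.+1 k2) cp isT.
  move=> i; rewrite geq_max => /andP[ji k2i]; split; first exact: sk.
  by apply: le_trans xk2 _; exact: now_le.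
by case: noB; exists i.
Qed.

Lemma observed_remote_time pi rho k x : correct pi -> correct rho ->
  x \in observed (st pi k) ->
  exists k', (x.2%:E <= remote_times (st rho k') pi)%E.
Proof.
move=> cp cr /(observed_beat rho cp)[j [le /(send_delivered cp cr)[k' e]]].
exists k'.+1; rewrite /= step_remote_times.
case: event_at e => [[]|[]|] //= pi' t [/srv_inj -> ->].
by rewrite eqxx le_max lee_fin le orbT.
Qed.

(** The correct servers alone form a quorum of [4 * f + 1], and each observes [x] and so beats past
    [x.2]; [g] records when [rho] has heard from each. *)
Lemma observed_lock_time pi rho k x : correct pi -> correct rho ->
  x \in observed (st pi k) -> exists k', (x.2%:E <= lock_time f (st rho k'))%E.
Proof.
move=> cp cr xk.
have /choice[g gP] : forall pi', exists k', correct pi' ->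
    (x.2%:E <= remote_times (st rho k') pi')%E.
  move=> pi'; have [cp'|] := boolP (correct pi'); last by exists 0%N.
  have [k1 /spotted_observed xk1] := observed_spotted_everywhere cp cp' xk.
  by have [k2 ?] := observed_remote_time cp' cr xk1; exists k2.
exists (\max_pi' g pi')%N; apply: ereal_sup_ubound => /=.
apply: leq_trans correct_card _; apply/subset_leq_card/fintype.subsetP => pi'.
rewrite !inE => /gP /le_trans; apply; apply: remote_times_le.
exact: leq_bigmax.
Qed.

(** * From a decision True to candidacy *)

Lemma remote_time_received pi rho k t :
  (t%:E <= remote_times (st rho k) pi)%E ->
  exists j u, [/\ (j < k)%N, ev rho j = ServerEv (RecvTime pi u) & t <= u].
Proof.
(* The initial remote time [-oo] is below every real [t], so a real lower bound must come from a
   message. *)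
elim: k => [|k IH]; first by rewrite leeNy_eq.
rewrite /= step_remote_times.
have old : (t%:E <= remote_times (st rho k) pi)%E ->
    exists j u, [/\ (j < k.+1)%N, ev rho j = ServerEv (RecvTime pi u) & t <= u].
  by move=> /IH[j [u [jk ? ?]]]; exists j, u; split=> //; exact: ltnW.
case E: event_at => [[pi' u| | | | | |]||] //; move: E.
case: eqP => // <- E; rewrite le_max => /orP[//|le].
by exists k, u; split=> //; rewrite -lee_fin.
Qed.

(* A quorum of 4f+1 remote times at least b meets the f+1 servers that proposed
   True before local time b; the link from a common server delivers its Observe
   message before any of its Time messages stamped at least b. *)
Lemma decides_true_candidate pi rho k x : correct pi -> correct rho ->
  decides pi x true k -> exists j, x \in candidates (st rho j).
Proof.
move=> cp cr /(con_representative_validity (ex_consensus exP x) cp)[A cardA AP].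
have before sigma : sigma \in A -> exists i b, [/\ correct sigma,
    Send (srv rho) (ObserveMsg x) \in out (srv sigma) i,
    (i <= b)%N & now sigma b < x.2].
  move=> /AP[cs [b /proposes_true[/spotted_observed /observed_spotted[i ib [xi xNi]] lt] _]].
  exists i, b; split=> //; exact: step_send_observe.
have someA : exists i, exists pi', ev rho i = ServerEv (RecvObserve pi' x).
  have /card_gt0P[sigma sA] : (0 < #|A|)%N by apply: leq_trans cardA; rewrite addn1.
  have [i [b [cs /(send_delivered cs cr)[k' e] _ _]]] := before _ sA.
  by exists k'; case: event_at e => [[]|[]|] //= pi' y [_ ->]; exists pi'.
(* The first spotting [k0] by [rho] suffices: if the lock time already excludes [x] there, FIFO
   order yields an earlier spotting, against minimality. *)
have exS : exists i, `[< spotted (ev rho i) = Some x >].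
  by have [i [pi' e]] := someA; exists i; apply/asboolP; rewrite e.
have [k0 /asboolP k0x k0min] := ex_minnP exS.
exists k0.+1; rewrite /= step_candidates k0x.
case: ltP => [_|locked]; first exact: fset1U1.
have [] := lock_time_max (f := f) (st rho k0).
  by rewrite n_servers leq_add2r leq_mul2r orbT.
set S := [pred _ | _] => cardS _.
have /existsP[sigma /andP[sA sS]] : [exists sigma, (sigma \in A) && (sigma \in S)].
  have [//|/existsPn disj] := boolP [exists sigma, (sigma \in A) && (sigma \in S)].
  have AS : (#|A| <= #|[predC S]|)%N.
    apply/subset_leq_card/fintype.subsetP => sigma sA.
    by have := disj sigma; rewrite sA inE.
  have := leq_add cardS (leq_trans cardA AS).
  by rewrite cardC n_servers addnACA -mulSnr leq_add2l.
have [i [b [cs xi ib lt]]] := before _ sA.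
have [j [u [jk ej xu]]] := remote_time_received (le_trans locked sS).
have ejd : delivery (ev rho j) = Some (srv sigma, TimeMsg u) by rewrite ej.
have [|j' j'j e] := delivered_after cs cr ejd xi.
  move=> i' /step_send_time ui'; rewrite ltnNge; apply/negP => i'i.
  have := now_le cs (leq_trans i'i ib); rewrite -ui'; apply/negP; rewrite -ltNge.
  exact: lt_le_trans lt xu.
have : (k0 <= j')%N.
  by apply: k0min; apply/asboolP; case: event_at e => [[]|[]|] //= ? ? [_ ->].
by rewrite leqNgt (ltn_trans j'j jk).
Qed.

(** * The processed sequence of one server *)

Definition processed_at pi k : seq triple :=
  if ev pi k is ServerEv (Process x) then [:: x] else [::].

Local Notation processed pi := (history (processed_at pi)).

Lemma processed_le pi j k x : (j <= k)%N ->
  x \in processed pi j -> x \in processed pi k.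
Proof. by move=> /(history_le (processed_at pi))[s ->]; rewrite mem_cat => ->. Qed.

Lemma process_processed pi k x : ev pi k = ServerEv (Process x) ->
  x \in processed pi k.+1.
Proof. by move=> e; rewrite historyS /processed_at e mem_cat mem_head orbT. Qed.

Lemma processed_process pi k x : x \in processed pi k ->
  exists2 j, (j < k)%N & ev pi j = ServerEv (Process x).
Proof.
elim: k => [//|k IH]; rewrite historyS mem_cat => /orP[/IH[j jk e]|].
  by exists j => //; exact: ltnW.
rewrite /processed_at; case E: event_at => [[| | | | | |y]||] //.
by rewrite mem_seq1 => /eqP ->; exists k.
Qed.

(** The [Process] guard gives the bound and lock times never decrease. Hence a later candidate,
    stamped above the lock time, lies above the last processed triple. *)
Lemma last_processed_lock_time pi k y : correct pi ->
  last_processed (st pi k) = Some y -> (y.2%:E <= lock_time f (st pi k))%E.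
Proof.
move=> cp; elim: k => [//|k IH] e; apply: le_trans (lock_time_le pi (leqnSn k)).
move: e (ex_guard exP k cp); rewrite /= step_last_processed.
case: event_at => [[??|??|???|??|?|?|x]|?|] /=; try by move=> /IH.
by move=> [->] [].
Qed.

Lemma processed_last pi k x : correct pi -> x \in processed pi k ->
  exists2 y, last_processed (st pi k) = Some y & (key x <= key y)%O.
Proof.
move=> cp; elim: k => [//|k IH]; rewrite historyS mem_cat /processed_at.
move: (ex_guard exP k cp); rewrite /= step_last_processed.
case: event_at => [[| | | | | |z]||] /=; rewrite ?orbF; try by move=> *; exact: IH.
move=> [/andP[_ lt] _ _ _]; rewrite mem_seq1 => xz; exists z => //.
case/orP: xz => [/IH[y ey xy]|/eqP -> //].
by move: lt; rewrite ey => /ltW; exact: le_trans.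
Qed.

Lemma unprocessed_notin pi k x : correct pi ->
  unprocessed (st pi k) x -> x \notin processed pi k.
Proof.
move=> cp /andP[_ lt]; apply/negP => /(processed_last cp)[y ey xy].
by move: lt; rewrite ey ltNge xy.
Qed.

(** No candidate is ever skipped: a new one is stamped above the lock time, hence lies above
    [last_processed], and [Process] always takes the least one left. *)
Lemma notin_unprocessed pi k x : correct pi -> x \in candidates (st pi k) ->
  x \notin processed pi k -> unprocessed (st pi k) x.
Proof.
move=> cp; elim: k => [//|k IH] xk xN; rewrite /unprocessed xk /=.
have {IH}IH : x \in candidates (st pi k) -> unprocessed (st pi k) x.
  by move=> /IH; apply; apply: contraNN xN; exact: processed_le.
have spot y : x \in (if (lock_time f (st pi k) < y.2%:E)%E
      then y |` candidates (st pi k) else candidates (st pi k)) ->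
    if last_processed (st pi k) is Some u then (key u < key x)%O else true.
  case: ltP => [ly|_ /IH/andP[] //].
  rewrite in_fset1U => /orP[/eqP ->|/IH/andP[] //].
  case E: last_processed => [u|//]; apply: key_lt; rewrite -lte_fin.
  exact: le_lt_trans (last_processed_lock_time cp E) ly.
move: xk xN (ex_guard exP k cp); rewrite historyS mem_cat /processed_at /=.
rewrite step_candidates step_last_processed.
case: event_at => [[pi' t|pi' y|th m b|y v|y|y|y]|e|] /=; try by move=> /IH /andP[].
- by move=> /spot.
- by move=> /(spot (th, m, b)).
move=> xk; rewrite mem_seq1 negb_or => /andP[_ xy] [_ ymin _ _].
by rewrite lt_neqAle ymin ?IH // andbT eq_sym (inj_eq key_inj).
Qed.

Lemma processed_sorted pi k : correct pi ->
  sorted (fun x y => key x < key y)%O (processed pi k).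
Proof.
move=> cp; elim: k => [//|k IH]; rewrite historyS /processed_at.
move: (ex_guard exP k cp).
case: event_at => [[| | | | | |z]||] /=; rewrite ?cats0 // => -[zu _ _ _].
have lt y : y \in processed pi k -> (key y < key z)%O.
  move=> /(processed_last cp)[u eu yu]; move: zu => /andP[_].
  by rewrite eu; exact: le_lt_trans.
case: (processed pi k) IH lt => [|a s] //= IH lt.
by rewrite cats1 rcons_path IH lt // mem_last.
Qed.

(** A later insertion of [z] would need a lock time below [z.2], but the lock time has reached
    [x.2], which is at least [z.2]. *)
Lemma candidates_frozen pi j k x z : (j <= k)%N ->
  (x.2%:E <= lock_time f (st pi j))%E -> (key z <= key x)%O ->
  z \in candidates (st pi k) -> z \in candidates (st pi j).
Proof.
move=> /subnKC <- locked /key_le zx; elim: (k - j)%N => [|d IH]; first by rewrite addn0.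
rewrite addnS /= step_candidates; case: spotted => // y.
case: ltP => // lt; rewrite in_fset1U => /orP[/eqP zy|//].
have := lt_le_trans lt (lexx y.2%:E).
have := le_trans locked (lock_time_le pi (leq_addr d j)).
by rewrite -zy => /le_lt_trans h /h; rewrite lte_fin ltNge zx.
Qed.

(* A key-minimal candidate below [x] that is never processed would eventually have
   its Process guard enabled forever. *)
Lemma candidate_processed pi k x : correct pi -> x \in candidates (st pi k) ->
  exists k', x \in processed pi k'.
Proof.
move=> cp xk; have [k1 locked] := observed_lock_time cp cp (candidates_observed xk).
pose K := maxn k k1.
have {locked} locked : (x.2%:E <= lock_time f (st pi K))%E.
  exact: le_trans locked (lock_time_le pi (leq_maxr _ _)).
have {xk} xK : x \in candidates (st pi K) by exact: candidates_le (leq_maxl _ _) xk.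
clearbody K.
pose done z := exists k', z \in processed pi k'.
have [//|xNdone] := pselect (done x).
(* From step [K] on no candidate at or below [x] is added, so this finite list is complete for
   good. *)
pose C := [seq z <- enum_fset (candidates (st pi K)) | (key z <= key x)%O].
have memC z : z \in C = (key z <= key x)%O && (z \in candidates (st pi K)).
  by rewrite mem_filter.
have [|z] := @seq_key_min _ _ _ key [seq z <- C | ~~ `[< done z >]] x.
  by rewrite mem_filter memC lexx xK !andbT; apply/asboolPn.
rewrite mem_filter memC => /andP[/asboolPn zNdone /andP[zx zK]] zmin.
have [k2 decided] := observed_decided cp cp (candidates_observed zK).
(* By minimality of [z], every smaller element of [C] gets processed; being finitely many, they
   share a bound. *)
have [k3 below] : exists k3, forall y, y \in [seq y <- C | (key y < key z)%O] ->
    y \in processed pi k3.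
  apply: (@eventually_all _ (fun k y => y \in processed pi k)).
    by move=> ? ? ?; exact: processed_le.
  move=> y; rewrite mem_filter => /andP[yz yC].
  have [//|yN] := pselect (done y).
  have := zmin y; rewrite mem_filter yC andbT leNgt yz => /(_ _)/notF[].
  exact/asboolPn.
have [|j _ ej] := @ex_progress _ _ _ _ _ _ _ _ _ _ _ _ _ _ _ exP (srv pi)
    (ServerEv (Process z)) (maxn K (maxn k2 k3)) cp isT; last first.
  by case: zNdone; exists j.+1; exact: process_processed ej.
move=> j; rewrite !geq_max => /and3P[Kj k2j k3j]; split.
- apply: notin_unprocessed => //; first exact: candidates_le Kj zK.
  by apply/negP => zj; apply: zNdone; exists j.
(* An unprocessed [y] below [z] would already be in [C], hence processed by step [k3]. *)
- move=> y yj; rewrite leNgt; apply/negP => yz.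
  have /negP[] := unprocessed_notin cp yj; apply: processed_le k3j _.
  apply: below; rewrite mem_filter yz memC; move: yj => /andP[yj _].
  have yx := le_trans (ltW yz) zx.
  by rewrite yx /=; exact: candidates_frozen locked yx yj.
- exact: decisions_le k2j decided.
- apply: le_trans (lock_time_le pi Kj); apply: le_trans locked.
  by rewrite lee_fin key_le.
Qed.

(** * Delivery sequences and their agreement *)

Definition decided_true x : bool :=
  `[< exists pi k, correct pi /\ decides pi x true k >].

(** Consensus agreement makes [decided_true] a property of the triple alone, so it can replace the
    local [decisions] map wherever a decision is present. *)
Lemma decisions_true pi k x : correct pi -> x \in decisions (st pi k) ->
  ((decisions (st pi k)).[? x] == Some true) = decided_true x.
Proof.
move=> cp xk.
have [v e] : exists v, (decisions (st pi k)).[? x] = Some v.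
  by rewrite (in_fnd xk); eexists.
rewrite e; have [j _ dv] := decisions_decides e.
apply/eqP/asboolP => [[v1]|[rho [i [cr di]]]].
  by exists pi, j; rewrite -v1.
by rewrite (con_agreement (ex_consensus exP x) cp cr dv di).
Qed.

Definition ordered pi k : seq triple := [seq x <- processed pi k | decided_true x].

(** The second conjunct serves the induction: [order] skips a pair exactly when it is in
    [delivered], that is, when it already occurs in the sequence. *)
Lemma deliveries_ordered pi k : correct pi ->
  history (tob_deliveries f srv cli delay_estimate margin ex pi) k =
    rev (undup (rev [seq x.1 | x <- ordered pi k])) /\
  delivered (st pi k) =i [seq x.1 | x <- ordered pi k].
Proof.
move=> cp; elim: k => [//|k [IH1 IH2]].
rewrite historyS IH1 /ordered historyS filter_cat map_cat.
rewrite {1}/tob_deliveries /outputs_at.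
rewrite -/(delivered_by (Proc:=Proc)) step_deliver /= step_delivered /processed_at.
move: (ex_guard exP k cp).
case: event_at => [[| | | | | |x]||] /=; rewrite ?cats0 // => -[_ _ xk _].
rewrite (decisions_true cp xk); case: decided_true => /=; last by rewrite !cats0.
split.
  rewrite [in RHS]cats1 rev_rcons /= mem_rev -IH2.
  by case: (_ \in delivered _); rewrite /= ?cats0 // rev_cons cats1.
by move=> d; rewrite in_fset1U IH2 mem_cat mem_seq1 orbC.
Qed.

(** Each element is eventually processed by [rho], and finitely many of them share a bound [K]. Both
    sequences increase, so it remains to see that the first is closed downwards in the second. *)
Lemma ordered_prefix pi rho k : correct pi -> correct rho ->
  exists K, prefix (ordered pi k) (ordered rho K).
Proof.
move=> cp cr.
have everywhere sigma x : correct sigma -> decided_true x ->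
    exists j, x \in processed sigma j.
  move=> cs /asboolP[pi' [i [cp' /(decides_true_candidate cp' cs)[j]]]].
  exact: candidate_processed.
have [|x|K Ksub] := @eventually_all _ (fun j x => x \in processed rho j) (ordered pi k).
- by move=> ? ? ?; exact: processed_le.
- by rewrite mem_filter => /andP[/(everywhere _ _ cr)].
have tr : transitive (fun x y : triple => key x < key y)%O by move=> ? ? ?; exact: lt_trans.
exists K; apply: (sorted_prefix (r := fun x y => key x < key y)%O) => //.
- by rewrite /ordered (sorted_filter tr) ?processed_sorted.
- by rewrite /ordered (sorted_filter tr) ?processed_sorted.
- move=> x xk; rewrite mem_filter Ksub // andbT.
  by move: xk; rewrite mem_filter => /andP[].
move=> x y; rewrite !mem_filter => /andP[xt _] /andP[_ yk] xy; rewrite xt /=.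
(* [pi] also processes [x] eventually; as its sequence increases and only grows at the end, [x],
   being below [y], cannot come after the first [k] steps. *)
have [j xj] := everywhere _ _ cp xt.
have := processed_sorted (maxn k j) cp.
have [s es] := history_le (processed_at pi) (leq_maxl k j).
have := processed_le (leq_maxr k j) xj.
rewrite es mem_cat sorted_pairwise // pairwise_cat => /orP[//|xs] /and3P[/allrelP lt _ _].
by have := lt_trans xy (lt _ _ yk xs); rewrite ltxx.
Qed.

(** Keeping first occurrences preserves prefixes, so a position filled at [pi] is filled alike at
    [rho]. The converse follows by exchanging the two servers. *)
Lemma nth_in_deliveries pi rho i d : correct pi -> correct rho ->
  nth_in (tob_deliveries f srv cli delay_estimate margin ex pi) i d ->
  nth_in (tob_deliveries f srv cli delay_estimate margin ex rho) i d.
Proof.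
move=> cp cr [k]; rewrite -/(history _ k) (deliveries_ordered k cp).1 => id.
have [K /prefixP[s es]] := ordered_prefix k cp cr.
exists K; rewrite -/(history _ K) (deliveries_ordered K cr).1 es map_cat.
have /prefixP[u ->] := prefix_rev_undup_rev [seq x.1 | x <- ordered pi k] [seq x.1 | x <- s].
exact: onth_prefix.
Qed.

End Run.

Theorem theorem8 (R : realType) (dC dM : Order.disp_t)
    (Client : orderType dC) (Msg : orderType dM)
    (Server : finType) (Proc : eqType)
    (f : nat) (srv : Server -> Proc) (cli : Client -> Proc)
    (delay_estimate margin Delta Psi : R)
    (ex : @execution R dC dM Client Msg Server Proc)
    (n_servers : #|Server| = (5 * f + 1)%N)
    (srv_inj : injective srv) (cli_inj : injective cli)
    (delay_estimate_gt0 : 0 < delay_estimate) (margin_gt0 : 0 < margin)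
    (exP : flutter_execution f srv cli delay_estimate margin ex Delta Psi)
    (pi pi' : Server)
    (pi_correct : correct_server srv ex pi)
    (pi'_correct : correct_server srv ex pi') :
  same_deliveries f srv cli delay_estimate margin ex pi pi'.
Proof. by split; exact: (nth_in_deliveries n_servers srv_inj exP). Qed.
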